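(* The type of almost symmetric numerical semigroups with embedding dimension $\nu(S)$ cannot be bounded by $2\nu(S)+a$ with $a\in\mathbb Z$; that is, for every $a\in\mathbb Z$ there exists an almost symmetric numerical semigroup $S$ such that $t(S)>2\nu(S)+a$.
   Context: A numerical semigroup is an additive submonoid $S$ of $\mathbb N=\{0,1,2,\dots\}$ with $\mathbb N\setminus S$ finite. Its embedding dimension $\nu(S)$ is the number of elements of its unique minimal system of generators. Write $M(S)=S\setminus\{0\}$ and let $\operatorname{F}(S)$ be the largest integer not in $S$. An integer $f\notin S$ is a pseudo-Frobenius number of $S$ if $f+s\in S$ for every $s\in M(S)$; the type $t(S)$ is the number of pseudo-Frobenius numbers of $S$. Let $K(S)=\{s\in\mathbb N\mid \operatorname{F}(S)-s\notin S\}$. $S$ is almost symmetric if $K(S)+M(S)\subseteq M(S)$; equivalently, $n+\operatorname{F}(S)-f\in S$ for every minimal generator $n$ of $S$ and every pseudo-Frobenius number $f$ of $S$. *)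

(* Defs.v *)
From mathcomp Require Import all_boot all_order all_algebra finmap.
From mathcomp Require Import all_classical.
From mathcomp Require Import zify.

Set Implicit Arguments.
Unset Strict Implicit.
Unset Printing Implicit Defensive.

Import Order.TTheory GRing.Theory Num.Theory.
Local Open Scope classical_set_scope.

Definition submonoid (S : set nat) : Prop :=
  S 0 /\ forall x y, S x -> S y -> S (x + y).

Definition numerical_semigroup (S : set nat) : Prop :=
  submonoid S /\ finite_set (~` S).

Definition generates (A S : set nat) : Prop := smallest submonoid A = S.

Definition minimal_generating_system (S A : set nat) : Prop :=
  generates A S /\ forall B : set nat, B `<=` A -> generates B S -> B = A.

(* The default value [set0] is never used: see [mingensP]. *)
Definition mingens (S : set nat) : set nat :=
  xget set0 (minimal_generating_system S).

Definition embedding_dimension (S : set nat) : nat := #|` fset_set (mingens S)|.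

Definition nonzero_part (S : set nat) : set nat := S `\ 0.

(* Frobenius and pseudo-Frobenius numbers are integers and may be negative:
   both are -1 for S = N. Hence S is regarded as a set of integers. *)
Definition intset (S : set nat) : set int := Posz @` S.

Definition is_frobenius (S : set nat) (F : int) : Prop :=
  ~ intset S F /\ forall z : int, ~ intset S z -> (z <= F)%R.

(* The default value [0] is never used: see [frobeniusP]. *)
Definition frobenius (S : set nat) : int := xget 0%R (is_frobenius S).

Definition pseudo_frobenius (S : set nat) : set int :=
  [set f | ~ intset S f /\
           forall s : nat, nonzero_part S s -> intset S (f + s%:Z)%R].

Definition semigroup_type (S : set nat) : nat :=
  #|` fset_set (pseudo_frobenius S)|.

Definition Kset (S : set nat) : set nat :=
  [set s | ~ intset S (frobenius S - s%:Z)%R].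

Definition almost_symmetric (S : set nat) : Prop :=
  [set x + y | x in Kset S & y in nonzero_part S] `<=` nonzero_part S.

Lemma numerical_semigroup_conductor (S : set nat) :
  numerical_semigroup S -> exists c, forall n, c <= n -> S n.
Proof.
move=> [_ fS]; exists (\max_(x <- fset_set (~` S)) x).+1 => n.
apply: contraPP => nS; apply/negP; rewrite -leqNgt.
by apply: leq_bigmax_seq => //; rewrite in_fset_set // inE.
Qed.

Lemma intset_nat (S : set nat) (n : nat) : intset S (Posz n) <-> S n.
Proof. by split=> [[m Sm [<-]]//|Sn]; exists n. Qed.

Lemma frobenius_exists (S : set nat) :
  numerical_semigroup S -> exists F, is_frobenius S F.
Proof.
move=> /numerical_semigroup_conductor exc.
have exc' : exists c, `[< forall n, c <= n -> S n >].
  by have [c cS] := exc; exists c; apply/asboolP.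
case: (ex_minnP exc') => c /asboolP cS cmin.
exists (c%:Z - 1)%R; split.
  case=> m Sm mc; have mE : c = m.+1 by lia.
  have /cmin : `[< forall n, m <= n -> S n >].
    apply/asboolP => n; rewrite leq_eqVlt => /predU1P[<-//|mn].
    by apply: cS; rewrite mE.
  by rewrite mE ltnn.
move=> z nz; rewrite leNgt; apply/negP => lt; apply: nz.
have [n zn] : exists n : nat, z = Posz n by exists `|z|%N; lia.
by rewrite zn; exists n => //; apply: cS; lia.
Qed.

Lemma frobeniusP (S : set nat) :
  numerical_semigroup S -> is_frobenius S (frobenius S).
Proof. by move=> /frobenius_exists; apply: xgetPex. Qed.

Lemma is_frobenius_inj (S : set nat) (F F' : int) :
  is_frobenius S F -> is_frobenius S F' -> F = F'.
Proof. by move=> [nF hF] [nF' hF']; apply/le_anti; rewrite hF' // hF. Qed.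

Lemma finite_pseudo_frobenius (S : set nat) :
  numerical_semigroup S -> finite_set (pseudo_frobenius S).
Proof.
move=> nS; have [c cS] := numerical_semigroup_conductor nS.
apply: (@sub_finite_set _ _ ((fun n : nat => n%:Z - c.+1%:Z)%R @` `I_(c + c.+1))).
  move=> f [nf hf]; have lt : (f < c%:Z)%R.
    rewrite ltNge; apply/negP => le; apply: nf; exists `|f|%N; last lia.
    by apply: cS; lia.
  have [m _ mE] : intset S (f + c.+1%:Z)%R.
    by apply: hf; split=> //; apply: cS.
  by exists m => /=; lia.
exact/finite_image/finite_II.
Qed.

Definition atoms (S : set nat) : set nat :=
  [set n | [/\ S n, n <> 0 &
    forall x y, S x -> S y -> x + y = n -> x = 0 \/ y = 0]].

Lemma submonoid_smallest (A : set nat) : submonoid (smallest submonoid A).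
Proof.
split=> [B [[B0 _] _]//|x y Ax Ay B BA].
by have [[_ addB] _] := BA; apply: addB; [apply: Ax|apply: Ay].
Qed.

Lemma atoms_sub_generates (S A : set nat) :
  generates A S -> atoms S `<=` A.
Proof.
move=> gA n [Sn n0 irr]; apply: contrapT => nA.
have [S0 addS] : submonoid S by rewrite -gA; apply: submonoid_smallest.
have AS : A `<=` S by rewrite -gA; apply: sub_gen_smallest.
have : smallest submonoid A `<=` S `\ n.
  apply: smallest_sub; last by move=> x Ax; split; [apply: AS|move=> /= xn; apply: nA; rewrite -xn].
  split; first by split=> //= /esym.
  move=> x y [Sx xn] [Sy yn]; split; first exact: addS.
  move=> /= xy; have [x0|y0] := irr _ _ Sx Sy xy.
    by apply: yn; rewrite /= -xy x0.
  by apply: xn; rewrite /= -xy y0 addn0.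
by rewrite gA => /(_ _ Sn)[_ /=].
Qed.

Lemma generates_atoms (S : set nat) : submonoid S -> generates (atoms S) S.
Proof.
move=> subS; apply/seteqP; split.
  by apply: smallest_sub => // n [].
move=> n; have [G0 addG] := submonoid_smallest (atoms S).
elim/ltn_ind: n => n IH Sn; have [->//|/eqP n0] := eqVneq n 0.
have [an|nan] := pselect (atoms S n); first exact: sub_gen_smallest.
have [x [y [Sx Sy xy x0 y0]]] :
    exists x y, [/\ S x, S y, x + y = n, x <> 0 & y <> 0].
  apply: contrapT => nex; apply: nan; split=> // x y Sx Sy xy.
  apply: contrapT => /not_orP[x0 y0]; apply: nex; exists x, y; split=> //.
by rewrite -xy; apply: addG; apply: IH => //; lia.
Qed.

Lemma minimal_generating_system_atoms (S A : set nat) : submonoid S ->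
  minimal_generating_system S A <-> A = atoms S.
Proof.
move=> subS; split=> [[gA minA]|->].
  by apply/esym/minA; [apply: atoms_sub_generates|apply: generates_atoms].
split; first exact: generates_atoms.
by move=> B sB gB; apply/seteqP; split=> //; apply: atoms_sub_generates.
Qed.

Lemma mingensP (S : set nat) :
  submonoid S -> minimal_generating_system S (mingens S).
Proof.
by move=> subS; apply: xgetPex; exists (atoms S); apply/minimal_generating_system_atoms.
Qed.

Lemma mingensE (S : set nat) : submonoid S -> mingens S = atoms S.
Proof. by move=> subS; apply/minimal_generating_system_atoms/mingensP. Qed.

Lemma finite_mingens (S : set nat) :
  numerical_semigroup S -> finite_set (mingens S).
Proof.
move=> nS; have [c cS] := numerical_semigroup_conductor nS.
rewrite mingensE; last by case: nS.
apply: (@sub_finite_set _ _ `I_(c.+1 + c.+1)); last exact: finite_II.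
move=> n [_ _ irr] /=; rewrite ltnNge; apply/negP => le.
have [] := irr c.+1 (n - c.+1); try apply: cS; lia.
Qed.

(* Main.v *)
Require Import Defs.
From mathcomp Require Import all_boot all_order all_algebra finmap.
From mathcomp Require Import all_classical.
From mathcomp Require Import zify ring.

Import Order.TTheory GRing.Theory Num.Theory.
Local Open Scope ring_scope.

(** For a numerical semigroup [S] with maximal ideal [M] and Frobenius number
    [F], let [T] be the set of integers [z] with [z + M <= M]. Then
    [2 S] together with the odd numbers [4 F + 1 - 2 w], [w] not in [T], is an
    almost symmetric semigroup (a numerical duplication of [S]). Its type is at
    least [2 |T \ S|], and its embedding dimension is at most that of [S] plus
    the number of [w] not in [T] such that [w + M <= T].

    It remains to find [S] for which [|T \ S|] exceeds the sum of these two
    numbers by an arbitrary amount. Start from <7, 9, 10>, replace each nonzero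
    element by [h = m ^ 2] copies indexed by [0 <= u < h], and keep only the
    copies of the three generators whose index lies in an additive 2-basis of
    [0, h) with at most [2 m] elements: all sums of two generators still get
    all their copies. Then [|T \ S|] is at least [5 h - 6 m] (the copies of the
    pseudo-Frobenius numbers 11 and 22 and the removed copies of 7, 9 and 10),
    there are at most [6 m] generators, and at most [4 h] integers [w] as above
    (copies of 0, 12, 13 and 15). *)

(** * Bounds on embedding dimension and type from finite lists *)

Lemma leq_embedding_dimension (S : set nat) (s : seq nat) :
  numerical_semigroup S -> (forall n, atoms S n -> n \in s) ->
  (embedding_dimension S <= size s)%N.
Proof.
move=> nS atS; rewrite /embedding_dimension; apply: uniq_leq_size => // n.
rewrite in_fset_set; last exact: finite_mingens.
by rewrite mingensE ?inE; [exact: atS|case: nS].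
Qed.

Lemma leq_semigroup_type (S : set nat) (s : seq int) :
  numerical_semigroup S -> uniq s ->
  (forall f, f \in s -> pseudo_frobenius S f) ->
  (size s <= semigroup_type S)%N.
Proof.
move=> nS us sPF; apply: uniq_leq_size => // f /sPF fPF.
by rewrite in_fset_set ?inE //; exact: finite_pseudo_frobenius.
Qed.

(** * The monoid [T = M - M] and the duplication *)

(** For [S] other than the set of all naturals, this is [S] together with its pseudo-Frobenius
    numbers. *)
Definition stabilizer (S : set nat) : set int :=
  [set z | forall s, nonzero_part S s -> intset (nonzero_part S) (z + s%:Z)].

(** The odd part reflects the complement of [T], so it absorbs [2 S]. The shift [4 * F + 1] is odd
    and puts every odd element above [2 * F]. *)
Definition double (S : set nat) (F : int) : set nat :=
  [set n | (exists2 s, S s & n = (2 * s)%N) \/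
           exists2 w, ~ stabilizer S w & n%:Z = 4 * F + 1 - 2 * w].

Lemma nonzero_intset {S : set nat} {z : int} :
  intset (nonzero_part S) z -> intset S z /\ 0 < z.
Proof. by case=> n [Sn /= n0] <-; split; [exists n|lia]. Qed.

Lemma intset_nonzero {S : set nat} {z : int} :
  intset S z -> 0 < z -> intset (nonzero_part S) z.
Proof. by case=> n Sn <- n0; exists n => //; split=> //= n0'; lia. Qed.

Lemma nonzero_partP {S : set nat} {n : nat} :
  nonzero_part S n <-> S n /\ (0 < n)%N.
Proof. by split=> [[Sn /= n0]|[Sn n0]]; split=> //=; lia. Qed.

Lemma frobenius_gt {S : set nat} {F z : int} :
  is_frobenius S F -> F < z -> intset S z.
Proof.
move=> [_ maxF] Fz; apply: contrapT => /maxF; lia.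
Qed.

Lemma stabilizer_gt {S : set nat} {F z : int} :
  is_frobenius S F -> 0 < F -> F < z -> stabilizer S z.
Proof.
move=> FS F0 Fz s _; apply: intset_nonzero; last lia.
by apply: (frobenius_gt FS); lia.
Qed.

(* Otherwise adding [z] to a positive element of [S] again and again would
   descend forever inside the positive elements of [S]. *)
Lemma stabilizer_ge0 {S : set nat} {z : int} :
  numerical_semigroup S -> stabilizer S z -> 0 <= z.
Proof.
move=> nS Tz; rewrite leNgt; apply/negP => z0.
have [c cS] := numerical_semigroup_conductor nS.
suff down (k : nat) (x : int) :
    intset (nonzero_part S) x -> x <= k%:Z -> False.
  have Mc : nonzero_part S c.+1.
    by apply/nonzero_partP; split=> //; exact: cS.
  by apply: (down c.+1 c.+1%:Z) => //; exists c.+1.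
elim: k x => [|k IH] x /[dup] Mx [s Ms sx] xk.
  by have [_] := nonzero_intset Mx; lia.
by apply: IH (Tz _ Ms) _; lia.
Qed.

Lemma stabilizerD {S : set nat} {z z' : int} :
  stabilizer S z -> stabilizer S z' -> stabilizer S (z + z').
Proof.
move=> Tz Tz' s Ms; have [n Mn nE] := Tz' _ Ms.
by rewrite -addrA -nE; exact: Tz.
Qed.

Lemma stabilizer_sub {S : set nat} {s : nat} :
  submonoid S -> S s -> stabilizer S s%:Z.
Proof.
move=> [_ addS] Ss n /nonzero_partP[Sn n0].
apply: intset_nonzero; last lia.
by exists (s + n)%N; [exact: addS|lia].
Qed.

Lemma double_even (S : set nat) (F z : int) :
  intset (double S F) (2 * z) <-> intset S z.
Proof.
split=> [[n [[s Ss nE]|[w _ wE]] nz]|[s Ss <-]]; try lia.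
  by exists s => //; lia.
by exists (2 * s)%N; [left; exists s|lia].
Qed.

Lemma double_odd (S : set nat) (F w : int) :
  is_frobenius S F -> 0 < F ->
  intset (double S F) (4 * F + 1 - 2 * w) <-> ~ stabilizer S w.
Proof.
move=> FS F0; split=> [[n [[s _ nE]|[v Tv vE]] nw]|Tw]; first lia.
  by have -> : w = v by lia.
have wF : w <= F by rewrite leNgt; apply/negP => /(stabilizer_gt FS F0).
by exists `|(4 * F + 1 - 2 * w)%R|%N; [right; exists w => //; lia|lia].
Qed.

Lemma int_parity (F z : int) :
  (exists v, z = 2 * v) \/ (exists v, z = 4 * F + 1 - 2 * v).
Proof.
have /orP[/eqP e|/eqP o] : ((z %% 2)%Z == 0) || ((z %% 2)%Z == 1) by lia.
  by left; exists (z %/ 2)%Z; lia.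
by right; exists (2 * F - (z %/ 2)%Z); lia.
Qed.

Lemma frobenius_le {S : set nat} {F z : int} :
  is_frobenius S F -> ~ intset S z -> z <= F.
Proof. by move=> [_]; apply. Qed.

Lemma notin_stabilizer_le {S : set nat} {F w : int} :
  is_frobenius S F -> 0 < F -> ~ stabilizer S w -> w <= F.
Proof.
by move=> FS F0 Tw; rewrite leNgt; apply/negP => /(stabilizer_gt FS F0).
Qed.

(** Used contrapositively: a gap of [S] lowered by an element of [M] lies outside [T]. *)
Lemma stabilizerB {S : set nat} {z : int} {s : nat} :
  nonzero_part S s -> stabilizer S (z - s%:Z) -> intset S z.
Proof. by move=> Ms /(_ _ Ms); rewrite subrK => /nonzero_intset[]. Qed.

Lemma doubleP {S : set nat} {F : int} {n : nat} : nonzero_part (double S F) n ->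
  (exists2 s, nonzero_part S s & n = (2 * s)%N) \/
  (exists2 w, ~ stabilizer S w & n%:Z = 4 * F + 1 - 2 * w).
Proof.
case/nonzero_partP=> [[[s Ss ->]|[w Tw wE]] n0].
  by left; exists s => //; apply/nonzero_partP; split=> //; lia.
by right; exists w.
Qed.

(** * Almost symmetry of the duplication *)

Lemma double_numerical_semigroup (S : set nat) (F : int) :
  numerical_semigroup S -> is_frobenius S F -> 0 < F ->
  numerical_semigroup (double S F).
Proof.
move=> [subS finS] FS F0; have [S0 addS] := subS.
(* [T] contains [S] and is closed under addition, so [w - s] in [T] would put [w] in [T]. *)
have mixed (s x : nat) (w : int) : S s -> ~ stabilizer S w ->
    x%:Z = 4 * F + 1 - 2 * w -> double S F (2 * s + x)%N.
  move=> Ss Tw xE; right; exists (w - s%:Z); last lia.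
  move=> T; apply: Tw; rewrite -(subrK s%:Z w).
  by apply: stabilizerD => //; exact: stabilizer_sub.
split; first split.
- by left; exists 0%N.
- move=> x y [[s Ss ->]|[w Tw wE]] [[s' Ss' ->]|[w' Tw' wE']].
  + by left; exists (s + s')%N; [exact: addS|lia].
  + exact: mixed wE'.
  + by rewrite addnC; exact: mixed wE.
  + apply/(@intset_nat (double S F)).
    have -> : Posz (x + y) = 2 * (4 * F + 1 - w - w') by lia.
    apply/double_even/(frobenius_gt FS).
    have := notin_stabilizer_le FS F0 Tw.
    have := notin_stabilizer_le FS F0 Tw'.
    by lia.
(* Past [4 * F + 1], even numbers are doubles of numbers above [F], and odd ones come from negative
   [v], never in [T]. *)
- apply: (@sub_finite_set _ _ `I_(`|(4 * F + 2)%R|%N)); last exact: finite_II.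
  move=> n nD /=; rewrite ltnNge; apply/negP => le; apply: nD.
  apply/(@intset_nat (double S F)).
  have [[v vE]|[v vE]] := int_parity F n%:Z; rewrite vE.
    by apply/double_even/(frobenius_gt FS); lia.
  apply/double_odd => // Tv.
  have := stabilizer_ge0 (conj subS finS) Tv; lia.
Qed.

Lemma double_frobenius (S : set nat) (F : int) :
  numerical_semigroup S -> is_frobenius S F -> 0 < F ->
  frobenius (double S F) = 4 * F + 1.
Proof.
move=> nS FS F0; have nD := double_numerical_semigroup S F nS FS F0.
apply: is_frobenius_inj (frobeniusP nD) _; split.
  rewrite -[4 * F + 1]subr0 -(mulr0 2) double_odd //; apply.
  by apply: stabilizer_sub; case: nS => [[]].
move=> z; have [[v ->]|[v ->]] := int_parity F z.
  rewrite double_even => /(frobenius_le FS); lia.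
rewrite double_odd // => /contrapT /(stabilizer_ge0 nS); lia.
Qed.

(** [K] consists of the [2 * u] with [u] in [T] and the [4 * F + 1 - 2 * v] with [v] outside [S].
    Mixed sums stay in the odd part because [T + T] lies in [T] and a gap minus an element of [M]
    avoids [T]; two odd numbers sum past [2 * F]. *)
Lemma double_almost_symmetric (S : set nat) (F : int) :
  numerical_semigroup S -> is_frobenius S F -> 0 < F ->
  almost_symmetric (double S F).
Proof.
move=> nS FS F0; have nD := double_numerical_semigroup S F nS FS F0.
move=> _ [x Kx [y My <-]]; apply/nonzero_partP; split; last first.
  by have [_] := iffLR nonzero_partP My; lia.
move: Kx; rewrite /Kset /= double_frobenius // => Kx.
apply/(@intset_nat (double S F)); rewrite PoszD; move: Kx.
have [[u xE]|[v xE]] := int_parity F x%:Z; rewrite xE.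
  rewrite double_odd // => /contrapT Tu.
  case: (doubleP My) => [[s Ms ->]|[w Tw wE]].
    have -> : 2 * u + Posz (2 * s) = 2 * (u + s%:Z) by lia.
    by apply/double_even; have [] := nonzero_intset (Tu _ Ms).
  rewrite wE; have -> : 2 * u + (4 * F + 1 - 2 * w) = 4 * F + 1 - 2 * (w - u).
    by ring.
  apply/double_odd => // T; apply: Tw; rewrite -(subrK u w).
  exact: stabilizerD.
have -> : 4 * F + 1 - (4 * F + 1 - 2 * v) = 2 * v by ring.
rewrite double_even => Sv.
case: (doubleP My) => [[s Ms ->]|[w Tw wE]].
  have -> : 4 * F + 1 - 2 * v + Posz (2 * s) = 4 * F + 1 - 2 * (v - s%:Z).
    by lia.
  by apply/double_odd => // /(stabilizerB Ms).
rewrite wE.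
have -> : 4 * F + 1 - 2 * v + (4 * F + 1 - 2 * w) = 2 * (4 * F + 1 - v - w).
  by ring.
apply/double_even/(frobenius_gt FS).
have := frobenius_le FS Sv; have := notin_stabilizer_le FS F0 Tw; lia.
Qed.

(** * Type and embedding dimension of the duplication *)

(** Each [f] in [T] but not in [S] yields two pseudo-Frobenius numbers, [2 * f] and its reflection
    [4 * F + 1 - 2 * f]. *)
Lemma double_semigroup_type (S : set nat) (F : int) (s : seq int) :
  numerical_semigroup S -> is_frobenius S F -> 0 < F ->
  uniq s -> (forall f, f \in s -> stabilizer S f /\ ~ intset S f) ->
  (2 * size s <= semigroup_type (double S F))%N.
Proof.
move=> nS FS F0 us sT.
pose s' := [seq 2 * f | f <- s] ++ [seq 4 * F + 1 - 2 * f | f <- s].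
have -> : (2 * size s = size s')%N by rewrite size_cat !size_map mul2n addnn.
apply: leq_semigroup_type; first exact: double_numerical_semigroup.
  have inj1 : injective (fun f : int => 2 * f) by move=> x y; lia.
  have inj2 : injective (fun f => 4 * F + 1 - 2 * f) by move=> x y; lia.
  rewrite cat_uniq !map_inj_uniq // us andbT /=.
  by apply/hasPn => _ /mapP[x _ ->]; apply/mapP => -[y _]; lia.
move=> f'; rewrite mem_cat => /orP[] /mapP[f /sT[Tf Sf] ->]; split.
- by rewrite double_even.
- move=> n /doubleP[[m Mm ->]|[w Tw wE]].
    have -> : 2 * f + Posz (2 * m) = 2 * (f + m%:Z) by lia.
    by apply/double_even; have [] := nonzero_intset (Tf _ Mm).
  rewrite wE; have -> : 2 * f + (4 * F + 1 - 2 * w) = 4 * F + 1 - 2 * (w - f).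
    by ring.
  apply/double_odd => // T; apply: Tw; rewrite -(subrK f w).
  exact: stabilizerD.
- by rewrite double_odd //; apply.
- move=> n /doubleP[[m Mm ->]|[w Tw wE]].
    have -> : 4 * F + 1 - 2 * f + Posz (2 * m) = 4 * F + 1 - 2 * (f - m%:Z).
      by lia.
    by apply/double_odd => // /(stabilizerB Mm).
  rewrite wE.
  have -> : 4 * F + 1 - 2 * f + (4 * F + 1 - 2 * w) = 2 * (4 * F + 1 - f - w).
    by ring.
  apply/double_even/(frobenius_gt FS).
  have := frobenius_le FS Sf; have := notin_stabilizer_le FS F0 Tw; lia.
Qed.

(** Even atoms are doubles of atoms of [S]. If [w + m] is outside [T] for some [m] in [M], the odd
    element of [w] is that of [w + m] plus [2 * m], so it is no atom. *)
Lemma double_embedding_dimension (S : set nat) (F : int)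
    (s : seq nat) (r : seq int) :
  numerical_semigroup S -> is_frobenius S F -> 0 < F ->
  (forall n, atoms S n -> n \in s) ->
  (forall w, ~ stabilizer S w ->
     (forall m, nonzero_part S m -> stabilizer S (w + m%:Z)) -> w \in r) ->
  (embedding_dimension (double S F) <= size s + size r)%N.
Proof.
move=> nS FS F0 sS rS.
pose t := [seq (2 * n)%N | n <- s] ++ [seq `|(4 * F + 1 - 2 * w)%R|%N | w <- r].
have -> : (size s + size r = size t)%N by rewrite size_cat !size_map.
apply: leq_embedding_dimension; first exact: double_numerical_semigroup.
move=> n [Dn n0 irr]; rewrite mem_cat; apply/orP.
have /doubleP[[m Mm nE]|[w Tw wE]] : nonzero_part (double S F) n by [].
  left; rewrite nE; apply/map_f/sS.
  have [Sm m0] := iffLR nonzero_partP Mm; split=> // [|x y Sx Sy xy]; first lia.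
  have [] := irr (2 * x)%N (2 * y)%N; try lia; left; [exists x|exists y] => //.
right; apply/mapP; exists w; last lia; apply: rS => // m Mm.
apply: contrapT => T; have /nonzero_partP[Sm m0] := Mm.
have [k kD kE] := iffRL (double_odd _ _ _ FS F0) T.
have [] := irr k (2 * m)%N => //; try lia.
by left; exists m.
Qed.

(** * A semigroup of large type and small embedding dimension *)

(* Every integer is [thick_point m y u] for exactly one integer [y] and one
   [0 <= u < m ^ 2]; adding two such points adds both coordinates, except that
   an overflow in [u] is reduced by [m ^ 2] at the cost of increasing [y] by
   [100 * m ^ 2 + 1]. *)
Definition thick_point (m : nat) (y u : int) : int :=
  (m * m)%:Z * (y + 100 * u) + u.

Definition ucoord (m : nat) (z : int) : int := (z %% (m * m)%:Z)%Z.

Definition ycoord (m : nat) (z : int) : int :=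
  (z %/ (m * m)%:Z)%Z - 100 * ucoord m z.

(** For [0 <= u < m ^ 2], at most one base [m] digit is nonzero: this is the additive 2-basis. *)
Definition sparse (m : nat) (u : int) : bool := (u < m%:Z) || (m%:Z %| u)%Z.

Definition gen7910 (y : int) : bool := [|| y == 7, y == 9 | y == 10].

(* The elements of <7, 9, 10> which are sums of at least two generators. *)
Definition deep7910 (y : int) : bool :=
  [|| y == 14, (16 <= y) && (y <= 21) | 23 <= y].

Definition thick_level (m : nat) (y u : int) : bool :=
  deep7910 y || gen7910 y && sparse m u.

Definition thick (m : nat) : set nat :=
  [set n | n = 0%N \/ thick_level m (ycoord m n%:Z) (ucoord m n%:Z)].

(** * Coordinates: level [y] and index [u] *)

Lemma ucoord_bounds {m : nat} (z : int) : (0 < m)%N ->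
  0 <= ucoord m z < (m * m)%:Z.
Proof.
move=> m0; have h0 : 0 < (m * m)%:Z by rewrite ltz_nat muln_gt0 m0.
by rewrite modz_ge0 ?ltz_pmod // lt0r_neq0.
Qed.

Lemma thick_pointE {m : nat} (z : int) :
  z = thick_point m (ycoord m z) (ucoord m z).
Proof.
by rewrite /thick_point subrK mulrC -divz_eq.
Qed.

Lemma thick_pointK {m : nat} {y u : int} : 0 <= u < (m * m)%:Z ->
  ycoord m (thick_point m y u) = y /\ ucoord m (thick_point m y u) = u.
Proof.
move=> hu; have uE : ucoord m (thick_point m y u) = u.
  by rewrite /ucoord /thick_point mulrC modzMDl modz_small.
split=> //; rewrite /ycoord uE /thick_point mulrC divzMDl; last by lia.
by rewrite divz_small ?addr0 ?addrK.
Qed.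

Lemma thick_point_inj {m : nat} {y y' u u' : int} :
  0 <= u < (m * m)%:Z -> 0 <= u' < (m * m)%:Z ->
  thick_point m y u = thick_point m y' u' -> y = y' /\ u = u'.
Proof.
move=> /thick_pointK hu /thick_pointK hu' e.
have [yE uE] := hu y; have [yE' uE'] := hu' y'.
by split; [rewrite -yE e|rewrite -uE e].
Qed.

Lemma thick_pointD (m : nat) (y y' u u' : int) :
  thick_point m y u + thick_point m y' u' = thick_point m (y + y') (u + u').
Proof. by rewrite /thick_point; ring. Qed.

Lemma thick_point_wrap (m : nat) (y u : int) :
  thick_point m y u =
  thick_point m (y + 100 * (m * m)%:Z + 1) (u - (m * m)%:Z).
Proof. by rewrite /thick_point; ring. Qed.

Lemma thick_point_gt0 {m : nat} {y u : int} : (0 < m)%N ->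
  0 < y -> 0 <= u -> 0 < thick_point m y u.
Proof.
move=> m0 y0 u0; have h0 : 0 < (m * m)%:Z by rewrite ltz_nat muln_gt0 m0.
by apply: ltr_wpDr => //; apply: mulr_gt0 => //; lia.
Qed.

Lemma thick_level_gt0 {m : nat} {y u : int} : thick_level m y u -> 0 < y.
Proof. rewrite /thick_level /deep7910 /gen7910; lia. Qed.

Lemma thick_nonzero {m : nat} {z : int} : (0 < m)%N ->
  intset (nonzero_part (thick m)) z <->
  thick_level m (ycoord m z) (ucoord m z).
Proof.
move=> m0; split=> [[n /nonzero_partP[[->|Bn] n0] <-]|Bz]; [by []|by []|].
have z0 : 0 < z.
  rewrite (@thick_pointE m z); apply: thick_point_gt0 => //.
    exact: thick_level_gt0 Bz.
  by have /andP[] := ucoord_bounds z m0.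
apply: intset_nonzero => //; exists `|z|%N; last lia.
by right; have -> : Posz `|z|%N = z by lia.
Qed.

Lemma thick_nonzero_point {m : nat} {y u : int} : (0 < m)%N ->
  0 <= u < (m * m)%:Z ->
  intset (nonzero_part (thick m)) (thick_point m y u) <-> thick_level m y u.
Proof.
by move=> m0 /thick_pointK hu; rewrite thick_nonzero //; have [-> ->] := hu y.
Qed.

Lemma thickP {m n : nat} : (0 < m)%N -> nonzero_part (thick m) n ->
  exists y u, [/\ n%:Z = thick_point m y u, 0 <= u < (m * m)%:Z &
                  thick_level m y u].
Proof.
move=> m0 Mn; exists (ycoord m n%:Z), (ucoord m n%:Z).
split; [exact: thick_pointE|exact: ucoord_bounds|].
by apply/(thick_nonzero m0); exists n.
Qed.

(* The coordinate [y] of the elements of [M - M] other than 0: besides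
   <7, 9, 10>, its pseudo-Frobenius numbers 11 and 22. *)
Definition stable7910 (y : int) : bool :=
  [|| gen7910 y, deep7910 y, y == 11 | y == 22].

(** * The stabilizer of the thickened semigroup *)

(** A stable level plus the level of a nonzero element is deep, and deep levels keep all copies, so
    indices do not matter. Overflow only lifts the level beyond 23. *)
Lemma stable_thick {m : nat} {y u : int} : (0 < m)%N ->
  0 <= u < (m * m)%:Z -> stable7910 y ->
  stabilizer (thick m) (thick_point m y u).
Proof.
move=> m0 hu sy s /(thickP m0)[y' [u' [-> hu' B]]].
rewrite thick_pointD.
have [lt|le] := ltP (u + u') (m * m)%:Z.
  apply/(thick_nonzero_point m0); first lia.
  move: sy B; rewrite /stable7910 /thick_level /deep7910 /gen7910; lia.
rewrite thick_point_wrap; apply/(thick_nonzero_point m0); first lia.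
move: sy B; rewrite /stable7910 /thick_level /deep7910 /gen7910; lia.
Qed.

Lemma sparse0 (m : nat) : (0 < m)%N -> sparse m 0.
Proof. by rewrite /sparse; lia. Qed.

Lemma sparse_split {m : nat} {u : int} : (0 < m)%N -> 0 <= u < (m * m)%:Z ->
  exists a b, [/\ u = a + b, 0 <= a, 0 <= b, sparse m a & sparse m b].
Proof.
move=> m0 hu; exists (u %% m%:Z)%Z, ((u %/ m%:Z)%Z * m%:Z).
split.
- by rewrite addrC -divz_eq.
- by rewrite modz_ge0 //; lia.
- by rewrite mulr_ge0 //; rewrite divz_ge0; lia.
- by rewrite /sparse ltz_pmod //; lia.
- by rewrite /sparse dvdz_mull // orbT.
Qed.

Lemma not_sparse {m : nat} {q r : int} :
  0 < q -> 0 < r < m%:Z -> ~~ sparse m (q * m%:Z + r).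
Proof.
move=> q0 hr; rewrite negb_or -leNgt; apply/andP; split; first by nia.
apply/negP => /dvdzP[q' e].
have : (q' - q) * m%:Z = r by rewrite mulrBl -e; ring.
by have [|] := leP (q' - q) 0; nia.
Qed.

(** Filling the digit where [u] vanishes leaves the basis. This keeps copies of 0 with nonzero
    sparse index out of [T]. *)
Lemma sparse_unstable {m : nat} {u : int} : (1 < m)%N ->
  0 < u < (m * m)%:Z -> sparse m u ->
  exists a, [/\ sparse m a, 0 <= a, u + a < (m * m)%:Z & ~~ sparse m (u + a)].
Proof.
move=> m1 hu; have [lt _|le] := ltP u m%:Z.
  exists m%:Z; split; first by rewrite /sparse dvdzz orbT.
  - by [].
  - by nia.
  - by rewrite addrC -[m%:Z in X in X + u]mul1r; apply: not_sparse; lia.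
rewrite /sparse ltNge le /= => /dvdzP[q uE].
have hq : 0 < q < m%:Z by nia.
exists 1; split=> //; [by lia|by nia|].
by rewrite uE; apply: not_sparse; lia.
Qed.

Lemma stabilizer_thick {m : nat} {y u : int} : (1 < m)%N ->
  0 <= u < (m * m)%:Z -> stabilizer (thick m) (thick_point m y u) ->
  (y = 0 /\ u = 0) \/ stable7910 y.
Proof.
move=> m1 hu T; have m0 : (0 < m)%N by lia.
have add (g a : int) : gen7910 g -> sparse m a -> 0 <= a ->
    u + a < (m * m)%:Z -> thick_level m (y + g) (u + a).
  move=> gg sa a0 ua; apply/(thick_nonzero_point m0); first lia.
  rewrite -thick_pointD.
  have [n Mn <-] : intset (nonzero_part (thick m)) (thick_point m g a).
    apply/(thick_nonzero_point m0); first lia.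
    by rewrite /thick_level gg sa orbT.
  exact: T.
(* Index 0 is sparse, so each generator can be added without changing [u]; the three resulting
   conditions leave only level 0 and the stable levels. *)
have add0 g (gg : gen7910 g) : thick_level m (y + g) u.
  have := add g 0 gg (sparse0 m m0) isT; rewrite addr0; apply; lia.
have B7 := add0 7 isT; have B9 := add0 9 isT; have B10 := add0 10 isT.
have [y0|sy] : y = 0 \/ stable7910 y; last by right.
  move: B7 B9 B10; rewrite /stable7910 /thick_level /deep7910 /gen7910; lia.
left; split=> //; apply/eqP; apply: contraT => u0.
have su : sparse m u.
  by move: B7; rewrite y0.
have hu0 : 0 < u < (m * m)%:Z by lia.
have [a [sa a0 ua /negP[]]] := sparse_unstable m1 hu0 su.
by have := add 7 a isT sa a0 ua; rewrite y0.
Qed.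

(** * The thickened semigroup and its Frobenius number *)

Lemma thick_numerical_semigroup (m : nat) : (0 < m)%N ->
  numerical_semigroup (thick m).
Proof.
move=> m0; split; first split; first by left.
- move=> x x' Sx Sx'; have [->|x0] := posnP x; first by [].
  have [->|x'0] := posnP x'; first by rewrite addn0.
  have Mx : nonzero_part (thick m) x by apply/nonzero_partP.
  have Mx' : nonzero_part (thick m) x' by apply/nonzero_partP.
  have [y [u [xE hu B]]] := thickP m0 Mx.
  have Tx : stabilizer (thick m) x%:Z.
    rewrite xE; apply: stable_thick => //; rewrite /stable7910.
    by case/orP: B => [->|/andP[-> _]]; rewrite ?orbT.
  by have [n [Sn _]] := Tx _ Mx'; rewrite -PoszD => -[<-].
(* The index [m * m] exceeds all admissible ones, so numbers this large cannot have level below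
   23. *)
- apply: (@sub_finite_set _ _ `I_(`|thick_point m 23 (m * m)%:Z|)%N);
    last exact: finite_II.
  move=> n nS /=; rewrite ltnNge; apply/negP => le; apply: nS; right.
  have hu := ucoord_bounds n%:Z m0.
  have := @thick_pointE m n%:Z; move: le hu.
  rewrite /thick_level /deep7910 /thick_point.
  set y := ycoord _ _; set u := ucoord _ _ => le hu nE.
  suff -> : 23 <= y by rewrite !orbT.
  rewrite leNgt; apply/negP => lt.
  have : (m * m)%:Z * (y + 100 * u) <= (m * m)%:Z * (23 + 100 * (m * m)%:Z).
    by apply: ler_wpM2l; lia.
  lia.
Qed.

(** [thick_point] increases in level and index, which outside the semigroup are at most 22 and
    [m * m - 1]. *)
Lemma thick_frobenius (m : nat) : (0 < m)%N ->
  is_frobenius (thick m) (thick_point m 22 ((m * m)%:Z - 1)).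
Proof.
move=> m0; have hh : 0 <= (m * m)%:Z - 1 < (m * m)%:Z by lia.
have F0 : 0 < thick_point m 22 ((m * m)%:Z - 1).
  by apply: thick_point_gt0; lia.
split=> [/intset_nonzero/(_ F0)/(thick_nonzero_point m0 hh)//|z nz].
have hu := ucoord_bounds z m0.
have lt23 : ycoord m z < 23.
  rewrite ltNge; apply/negP => ge; apply: nz.
  have [] // := @nonzero_intset (thick m) z.
  by apply/(thick_nonzero m0); rewrite /thick_level /deep7910 ge !orbT.
rewrite {1}(@thick_pointE m z) /thick_point; move: hu lt23.
set y := ycoord _ _; set u := ucoord _ _ => hu lt23.
by apply: lerD; [apply: ler_wpM2l|]; lia.
Qed.

(** * Counting atoms and pseudo-Frobenius numbers *)

Definition sparse_seq (m : nat) : seq int :=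
  [seq i%:Z | i <- iota 0 m] ++ [seq (m * i)%:Z | i <- iota 0 m].

Lemma mem_sparse_seq {m : nat} {u : int} :
  0 <= u < (m * m)%:Z -> sparse m u -> u \in sparse_seq m.
Proof.
move=> hu; rewrite mem_cat => /orP[lt|/dvdzP[q uE]]; apply/orP.
  by left; apply/mapP; exists `|u|%N; [rewrite mem_iota|]; lia.
by right; apply/mapP; exists `|q|%N; [rewrite mem_iota|]; nia.
Qed.

Lemma size_sparse_seq (m : nat) : size (sparse_seq m) = (2 * m)%N.
Proof. by rewrite size_cat !size_map !size_iota mul2n addnn. Qed.

Definition int_iota (h : nat) : seq int := [seq i%:Z | i <- iota 0 h].

Lemma mem_int_iota (h : nat) (u : int) : (u \in int_iota h) = (0 <= u < h%:Z).
Proof.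
apply/mapP/idP => [[i] |hu]; first by rewrite mem_iota => hi ->; lia.
by exists `|u|%N; [rewrite mem_iota|]; lia.
Qed.

Lemma uniq_int_iota (h : nat) : uniq (int_iota h).
Proof. by rewrite map_inj_uniq ?iota_uniq // => x y []. Qed.

Lemma size_int_iota (h : nat) : size (int_iota h) = h.
Proof. by rewrite size_map size_iota. Qed.

Definition dense_seq (m : nat) : seq int :=
  [seq u <- int_iota (m * m) | ~~ sparse m u].

Lemma size_dense_seq (m : nat) : (m * m <= size (dense_seq m) + 2 * m)%N.
Proof.
rewrite -{1}(size_int_iota (m * m)) -(count_predC (sparse m)) addnC.
rewrite size_filter leq_add2l -size_filter -size_sparse_seq.
apply: uniq_leq_size; first by rewrite filter_uniq // uniq_int_iota.
move=> u; rewrite mem_filter mem_int_iota => /andP[su hu].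
exact: mem_sparse_seq.
Qed.

(** At a deep level, the level splits into a generator plus another level and the index into two
    sparse ones, so the element is a sum of two nonzero elements. *)
Lemma thick_atoms (m n : nat) : (0 < m)%N -> atoms (thick m) n ->
  n \in [seq `|thick_point m y u|%N | y <- [:: 7; 9; 10], u <- sparse_seq m].
Proof.
move=> m0 [Sn n0 irr].
have Mn : nonzero_part (thick m) n by [].
have [y [u [nE hu B]]] := thickP m0 Mn.
case/orP: B => [dy|/andP[gy su]]; last first.
  apply/allpairsP; exists (y, u); split; last by rewrite /= -nE.
    by move: gy; rewrite /gen7910 !inE.
  exact: mem_sparse_seq.
have [a [b [uE a0 b0 sa sb]]] := sparse_split m0 hu.
have [g gg Bg] : exists2 g, gen7910 g & gen7910 (y - g) || deep7910 (y - g).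
  have : [|| gen7910 (y - 7) || deep7910 (y - 7),
             gen7910 (y - 9) || deep7910 (y - 9)
           | gen7910 (y - 10) || deep7910 (y - 10)].
    by move: dy; rewrite /gen7910 /deep7910; lia.
  by case/or3P; [exists 7|exists 9|exists 10].
have [k Mk kE] : intset (nonzero_part (thick m)) (thick_point m g a).
  apply/(thick_nonzero_point m0); first lia.
  by rewrite /thick_level gg sa orbT.
have [l Ml lE] : intset (nonzero_part (thick m)) (thick_point m (y - g) b).
  apply/(thick_nonzero_point m0); first lia.
  by rewrite /thick_level sb andbT orbC.
have [Sk k0] := iffLR nonzero_partP Mk; have [Sl l0] := iffLR nonzero_partP Ml.
have kl : (k + l)%N = n.
  apply/eqP; rewrite -eqz_nat PoszD kE lE nE thick_pointD uE; apply/eqP.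
  by congr thick_point; ring.
by have [] := irr _ _ Sk Sl kl; lia.
Qed.

Definition thick_second (m : nat) : seq int :=
  [seq thick_point m y u | y <- [:: 0; 12; 13; 15], u <- int_iota (m * m)].

(** Adding the copies of index 0 suffices: [y + 7], [y + 9] and [y + 10] must each be 0 or stable
    while [y] is not stable, which leaves 0, 12, 13 and 15. *)
Lemma mem_thick_second (m : nat) (w : int) : (1 < m)%N ->
  ~ stabilizer (thick m) w ->
  (forall s, nonzero_part (thick m) s -> stabilizer (thick m) (w + s%:Z)) ->
  w \in thick_second m.
Proof.
move=> m1 Tw Tws; have m0 : (0 < m)%N by lia.
have hu := ucoord_bounds w m0; have wE := @thick_pointE m w.
move: hu wE; set y := ycoord m w; set u := ucoord m w => hu wE.
have add g : gen7910 g -> y + g = 0 \/ stable7910 (y + g).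
  move=> gg.
  have [s Ms sE] : intset (nonzero_part (thick m)) (thick_point m g 0).
    apply/(thick_nonzero_point m0); first lia.
    by rewrite /thick_level gg sparse0 // orbT.
  have := Tws _ Ms; rewrite wE sE thick_pointD addr0.
  by case/(stabilizer_thick m1 hu) => [[]|]; [left|right].
have sy : ~~ stable7910 y.
  by apply/negP => sy; apply: Tw; rewrite wE; exact: stable_thick.
apply/allpairsP; exists (y, u); split=> //=; last by rewrite mem_int_iota.
move: (add 7 isT) (add 9 isT) (add 10 isT) sy; rewrite !inE.
rewrite /stable7910 /gen7910 /deep7910; lia.
Qed.

Definition thick_pseudo (m : nat) : seq int :=
  [seq thick_point m y u | y <- [:: 11; 22], u <- int_iota (m * m)] ++
  [seq thick_point m y u | y <- [:: 7; 9; 10], u <- dense_seq m].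

Lemma dense_seqP {m : nat} {u : int} :
  u \in dense_seq m -> 0 <= u < (m * m)%:Z /\ ~~ sparse m u.
Proof. by rewrite mem_filter mem_int_iota => /andP[]. Qed.

Lemma mem_thick_pseudo (m : nat) (f : int) : (0 < m)%N ->
  f \in thick_pseudo m -> stabilizer (thick m) f /\ ~ intset (thick m) f.
Proof.
move=> m0.
have pf y u : 0 <= u < (m * m)%:Z -> stable7910 y -> ~~ thick_level m y u ->
    stabilizer (thick m) (thick_point m y u) /\
    ~ intset (thick m) (thick_point m y u).
  move=> hu sy /negP nB; split=> [|Sf]; first exact: stable_thick.
  apply/nB/(thick_nonzero_point m0 hu)/(intset_nonzero Sf).
  apply: thick_point_gt0 => //; last by case/andP: hu.
  by move: sy; rewrite /stable7910 /gen7910 /deep7910; lia.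
rewrite mem_cat => /orP[] /allpairsP[[y u] /= [hy hu ->]].
  rewrite mem_int_iota in hu; apply: pf => //.
    by move: hy; rewrite !inE => /orP[]/eqP->.
  by move: hy; rewrite !inE => /orP[]/eqP->.
have [hu' su] := dense_seqP hu; apply: pf => //.
  by move: hy; rewrite !inE => /or3P[]/eqP->.
rewrite /thick_level (negPf su) andbF orbF.
by move: hy; rewrite !inE => /or3P[]/eqP->.
Qed.

Lemma uniq_thick_points (m : nat) (ys us : seq int) :
  uniq ys -> uniq us -> {in us, forall u, 0 <= u < (m * m)%:Z} ->
  uniq [seq thick_point m y u | y <- ys, u <- us].
Proof.
move=> uys uus hus; apply: allpairs_uniq => // -[y u] [y' u'].
move=> /allpairsP[[? ?] [/= _ /hus hu [-> ->]]].
move=> /allpairsP[[? ?] [/= _ /hus hu' [-> ->]]].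
by move=> /(thick_point_inj hu hu')[-> ->].
Qed.

Lemma uniq_thick_pseudo (m : nat) : uniq (thick_pseudo m).
Proof.
rewrite cat_uniq; apply/and3P; split.
- apply: uniq_thick_points => //; first exact: uniq_int_iota.
  by move=> u; rewrite mem_int_iota.
- apply/hasPn => _ /allpairsP[[y u] [hy /dense_seqP[hu _] ->]].
  apply/negP => /allpairsP[[y' u'] [hy' hu']].
  rewrite mem_int_iota in hu'; move=> /(thick_point_inj hu hu')[yy _].
  by move: hy hy'; rewrite /= in yy *; rewrite yy !inE; lia.
- apply: uniq_thick_points => //; first by rewrite filter_uniq // uniq_int_iota.
  by move=> u /dense_seqP[].
Qed.

(** * Choice of the parameter *)

Theorem mainTheorem3 : forall a : int, exists S : set nat,
  [/\ numerical_semigroup S,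
      almost_symmetric S &
      (semigroup_type S)%:Z > 2 * (embedding_dimension S)%:Z + a].
Proof.
(* With [h = m ^ 2], the type is at least [10 h - 12 m] and twice the embedding dimension at most
   [8 h + 12 m]. Thus [2 h - 24 m = 2 m (m - 12)] must exceed [a], and [m = |a| + 13] suffices. *)
move=> a; pose m := (`|a| + 13)%N; have m0 : (0 < m)%N by lia.
have nS := thick_numerical_semigroup m m0; have FS := thick_frobenius m m0.
set F := thick_point _ _ _ in FS.
have F0 : 0 < F by apply: thick_point_gt0; lia.
exists (double (thick m) F); split.
- exact: double_numerical_semigroup.
- exact: double_almost_symmetric.
have t := @double_semigroup_type _ _ _ nS FS F0 (uniq_thick_pseudo m)
  (fun f => @mem_thick_pseudo m f m0).
have m1 : (1 < m)%N by lia.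
have e := @double_embedding_dimension _ _ _ _ nS FS F0
  (fun n => @thick_atoms m n m0) (fun w => @mem_thick_second m w m1).
have d := size_dense_seq m.
move: t e; rewrite /thick_pseudo /thick_second size_cat !size_allpairs.
rewrite size_int_iota size_sparse_seq /=.
have : (2 * (m * m) >= 24 * m + `|a| + 1)%N by rewrite /m; nia.
lia.
Qed.
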